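(* If $G$ is a $2$-connected graph, then $md(G)\leq\alpha(G)$. The bound is sharp, i.e. there exist $2$-connected graphs $G$ with $md(G)=\alpha(G)$.
   Context: Graphs are finite and simple. $\alpha(G)$ is the independent number of $G$, i.e. the order of a maximum independent set. An edge-coloring of $G$ assigns a color (positive integer) to each edge; adjacent edges may have the same color. An edge-cut is monochromatic if all of its edges have the same color. An edge-coloring of $G$ is a monochromatic disconnection coloring ($MD$-coloring) if every two distinct vertices of $G$ are separated by a monochromatic edge-cut (i.e. there is a set of edges of a single color whose deletion puts the two vertices in different components). For a connected graph $G$, $md(G)$ is the maximum number of colors used in an $MD$-coloring of $G$. *)

(* Defs.v *)
From HB Require Import structures.
From mathcomp Require Import all_boot.
From mathcomp Require Import boolp.

Set Implicit Arguments.
Unset Strict Implicit.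
Unset Printing Implicit Defensive.

Record sgraph : Type := SGraph {
  vertex :> finType;
  adj : rel vertex;
  adj_sym : symmetric adj;
  adj_irrefl : irreflexive adj }.

Definition edges (G : sgraph) : {set {set G}} :=
  [set [set p.1; p.2] | p : G * G & adj p.1 p.2].

Definition independent (G : sgraph) (A : {set G}) : bool :=
  [forall x in A, forall y in A, ~~ adj x y].

Definition alpha (G : sgraph) : nat := \max_(A : {set G} | independent A) #|A|.

Definition connected_on (G : sgraph) (A : {set G}) : bool :=
  [forall x in A, forall y in A,
     connect [rel u v | [&& u \in A, v \in A & adj u v]] x y].

(* More than k vertices, and no deletion of fewer than k vertices disconnects:
   in particular the complete graph on two vertices is not 2-connected. *)
Definition k_connected (k : nat) (G : sgraph) : bool :=
  (k < #|G|) && [forall S : {set G}, (#|S| < k) ==> connected_on (~: S)].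

Definition edge_deletion (G : sgraph) (F : {set {set G}}) : rel G :=
  [rel u v | adj u v && ([set u; v] \notin F)].

Definition separates (G : sgraph) (F : {set {set G}}) (x y : G) : bool :=
  ~~ connect (edge_deletion F) x y.

(* A colouring is a total function on vertex sets, but only its values on
   edges matter: every definition below consults it on edges only. *)
Definition edge_coloring (G : sgraph) (c : {set G} -> nat) : Prop :=
  forall f, f \in edges G -> 0 < c f.

Definition monochromatic (G : sgraph) (c : {set G} -> nat)
    (F : {set {set G}}) : Prop :=
  exists i : nat, forall f, f \in F -> c f = i.

Definition MD_coloring (G : sgraph) (c : {set G} -> nat) : Prop :=
  edge_coloring c /\
  forall x y : G, x != y ->
    exists F : {set {set G}},
      [/\ F \subset edges G, monochromatic c F & separates F x y].

Definition num_colors (G : sgraph) (c : {set G} -> nat) : nat :=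
  size (undup [seq c f | f in edges G]).

Lemma num_colors_le (G : sgraph) (c : {set G} -> nat) :
  num_colors c <= #|edges G|.
Proof. by rewrite (leq_trans (size_undup _)) // size_map -cardE. Qed.

(* By num_colors_le the range of k is no restriction; md_attained and
   md_upper show that this is a genuine maximum. *)
Definition md (G : sgraph) : nat :=
  \max_(k < #|edges G|.+1 |
        `[< exists2 c : {set G} -> nat, MD_coloring c & num_colors c = k >]) k.

Lemma md_upper (G : sgraph) (c : {set G} -> nat) :
  MD_coloring c -> num_colors c <= md G.
Proof.
move=> mdc; have lt_k : num_colors c < #|edges G|.+1 by exact: num_colors_le.
rewrite /md (bigD1 (Ordinal lt_k)) /= ?leq_maxl //.
by apply/asboolP; exists c.
Qed.

Lemma const_MD_coloring (G : sgraph) : MD_coloring (fun _ : {set G} => 1).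
Proof.
split=> // x y neq_xy; exists (edges G); split=> //; first by exists 1.
apply/negP => /connectP[[|z p] /=].
  by move=> _ eq_yx; rewrite eq_yx eqxx in neq_xy.
case/andP=> /andP[adj_xz /negP xz_notin] _ _; apply: xz_notin.
by apply/imsetP; exists (x, z) => /=; rewrite ?in_set.
Qed.

Lemma md_attained (G : sgraph) :
  exists2 c : {set G} -> nat, MD_coloring c & num_colors c = md G.
Proof.
have mdc := const_MD_coloring G; set c := (fun _ => 1) in mdc.
have lt_k : num_colors c < #|edges G|.+1 by exact: num_colors_le.
have P0 : `[< exists2 d : {set G} -> nat,
             MD_coloring d & num_colors d = Ordinal lt_k >].
  by apply/asboolP; exists c.
rewrite /md (bigmax_eq_arg (Ordinal lt_k)) //.
by case: arg_maxnP => //= k /asboolP.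
Qed.

(* Main.v *)
Require Import Defs.
From HB Require Import structures.
From mathcomp Require Import all_boot.
From mathcomp Require Import zify.

(** Let c be an MD-coloring of a 2-connected graph. An edge uv of color i can
    only be separated in color i, and this forces every color to occur at least
    twice on each cycle that carries it. The bound is the case of the whole
    vertex set in [colors_le_independent], which is about vertex sets A inducing
    a connected graph without cut vertex, a single edge included. It produces an
    independent set with as many vertices as there are colors on A, by induction
    on the size of A.

    Let H be a maximal proper subset of A, with at least two vertices, that
    again induces such a graph, and let x, s, y be a shortest ear of H in A: a
    path with distinct ends x, y in H and with all inner vertices s outside H.
    Adding an ear keeps the graph nonseparable ([ear_nonseparable]), so A is the
    union of H and s. As the ear is shortest, s induces a path, and only its
    first vertex may see x and only its last one may see y, nothing else of H
    being seen, unless s is a single vertex.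

    Call a color old if it occurs on H, and let m be the number of new ones.
    They all occur on the ear ([colors_shortest_ear]), each at least twice
    ([ear_new_color]), while a color separating x from y must be old and occur on
    the ear ([ear_old_color]). Hence the ear, which has one more edge than s has
    vertices, satisfies 2m <= |s|.

    If 2m < |s|, every second vertex of s without its two ends gives m vertices
    with no neighbor in H, to be added to the independent set that induction
    gives for H ([extend_independent_long]). If 2m = |s|, the ear has exactly one
    edge of an old color i. Then H with the additional edge xy of color i is
    still separated by its colors ([chord_separated]), so induction gives an
    independent set I of H that misses x or y. When it misses x, every second
    vertex of s, starting with the neighbor of x, can be added to I; when it
    misses y, the same holds for the reversed ear ([extend_independent_short]).

    The triangle shows sharpness: its independence number is 1, and one color
    can always be used. *)

Set Implicit Arguments.
Unset Strict Implicit.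
Unset Printing Implicit Defensive.

(** * Counting in sequences *)

Lemma double_size_undup_le (T : eqType) (s : seq T) :
  (forall a, a \in s -> 1 < count_mem a s) -> 2 * size (undup s) <= size s.
Proof.
move=> dbl; have /perm_size <- := perm_count_undup s.
have {dbl}: all (fun a => 1 < count_mem a s) (undup s).
  by apply/allP => a; rewrite mem_undup => /dbl.
elim: (undup s) => //= a u IH /andP[lt1 /IH le_u].
by rewrite size_cat size_nseq mulnS leq_add.
Qed.

Lemma mem_split (T : eqType) (a : T) s :
  a \in s -> exists s1 s2, s = s1 ++ a :: s2.
Proof. by case/splitPr => s1 s2; exists s1, s2. Qed.

Section Alternate.
Variable T : eqType.

Fixpoint alternate (s : seq T) : seq T :=
  if s is a :: s' then a :: (if s' is _ :: s'' then alternate s'' else [::])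
  else [::].

Lemma alternate_ind (P : seq T -> Prop) :
  P [::] -> (forall a, P [:: a]) -> (forall a b s, P s -> P [:: a, b & s]) ->
  forall s, P s.
Proof.
move=> P0 P1 P2; fix IH 1 => -[|a [|b s]]; [exact: P0 | exact: P1 | exact/P2/IH].
Qed.

Lemma alternate_subseq s : subseq (alternate s) s.
Proof.
elim/alternate_ind: s => [|a|a b s IH] //=; first by rewrite eqxx.
by rewrite eqxx; apply: subseq_trans IH (subseq_cons s b).
Qed.

Lemma size_alternate s : size (alternate s) = uphalf (size s).
Proof. by elim/alternate_ind: s => [|a|a b s IH] //=; rewrite IH. Qed.

(** The sequence s stands for the vertices of an induced path, chords being
    excluded by the last hypothesis; two members of [alternate s] are never
    consecutive on it. *)
Lemma alternate_independent (e : rel T) s :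
  symmetric e -> irreflexive e ->
  (forall s1 a s2 b s3, s = s1 ++ a :: s2 ++ b :: s3 -> e a b -> s2 = [::]) ->
  {in alternate s &, forall a b, ~~ e a b}.
Proof.
move=> esym eirr; elim/alternate_ind: s => [|a|a b s IH] //= chordless.
  by move=> u v; rewrite !inE => /eqP-> /eqP->; rewrite eirr.
have far z : z \in alternate s -> ~~ e a z.
  move/(mem_subseq (alternate_subseq s)) => z_s; apply/negP => eaz.
  case/splitPr: z_s chordless => s2 s3 chordless.
  by have := chordless [::] a (b :: s2) z s3 erefl eaz.
move=> u v; rewrite !inE => /predU1P[->|u_s] /predU1P[->|v_s].
- by rewrite eirr.
- exact: far.
- by rewrite esym; apply: far.
- apply: IH u_s v_s => s1 u' s2 v' s3 s_def.
  by apply: (chordless (a :: b :: s1) _ _ _ s3); rewrite s_def.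
Qed.

End Alternate.

Lemma leq_uphalf m k : 2 * m <= k.+1 -> m <= uphalf k.
Proof. lia. Qed.

(** The segments s1 and s2 are the two end vertices of s; when s has at most one
    vertex, the middle segment is empty and m is 0. *)
Lemma inner_segment (T : eqType) (s : seq T) m : 2 * m < size s ->
  exists s1 r s2, [/\ s = s1 ++ r ++ s2, r != [::] -> s1 != [::],
                      r != [::] -> s2 != [::] & m <= uphalf (size r)].
Proof.
case: s => [|h t]; first by rewrite ltn0.
case/lastP: t => [|r l] lt_m.
  by exists [:: h], [::], [::]; split=> //; move: lt_m => /=; lia.
exists [:: h], r, [:: l]; rewrite -cats1; split=> //; apply: leq_uphalf.
by move: lt_m; rewrite /= size_rcons.
Qed.

(** * Nonseparable sets and separating colors *)

Section Graph.
Variable V : finType.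
Implicit Types (e : rel V) (A B H : {set V}) (c : V -> V -> nat).
Implicit Types (x y z : V) (s p : seq V).

Definition within e A : rel V := [rel u v | [&& u \in A, v \in A & e u v]].

Definition conn e A :=
  [forall x in A, forall y in A, connect (within e A) x y].

(** Unlike 2-connectedness, this admits a single edge, which is the starting
    point of the ear construction. *)
Definition nonseparable e A :=
  [forall S : {set V}, (#|S| < 2) ==> conn e (A :\: S)].

Definition avoid e c i : rel V := [rel u v | e u v && (c u v != i)].

(** Edges are colored through pairs of endpoints, which lets an edge be added
    with a color of choice. *)
Definition separated e c A :=
  forall x y, x \in A -> y \in A -> x != y ->
    exists i, ~~ connect (within (avoid e c i) A) x y.

Definition colors e c A : seq nat :=
  [seq c q.1 q.2 | q : V * V in [pred q | within e A q.1 q.2]].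

(** The sequence s lists the inner vertices only; being nonempty, it rules out
    that an edge inside H counts as an ear. *)
Definition ear e A H x s y :=
  [&& x \in H, y \in H, x != y, s != [::], path e x (rcons s y)
    & all (mem (A :\: H)) s].

Lemma connP e A :
  reflect {in A &, forall x y, connect (within e A) x y} (conn e A).
Proof.
apply: (iffP forall_inP) => [h x y xA yA | h x xA].
  by move/forall_inP: (h x xA); apply.
by apply/forall_inP => y; apply: h.
Qed.

Lemma nonseparableP e A :
  reflect (forall S : {set V}, #|S| < 2 -> conn e (A :\: S)) (nonseparable e A).
Proof.
by apply: (iffP forallP) => h S; [apply/implyP | apply/implyP/h].
Qed.

Lemma within_sym e A : symmetric e -> symmetric (within e A).
Proof. by move=> esym u v; rewrite /within /= esym andbCA. Qed.

Lemma avoid_sym e c i :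
  symmetric e -> (forall u v, c u v = c v u) -> symmetric (avoid e c i).
Proof. by move=> esym csym u v; rewrite /avoid /= esym csym. Qed.

Lemma connect_within_sym e A x y :
  symmetric e -> connect (within e A) x y = connect (within e A) y x.
Proof. by move=> esym; apply/sym_connect_sym/within_sym. Qed.

Lemma connect_within_mono e e' A B x y :
  (forall u v, u \in A -> v \in A -> e u v -> e' u v) -> A \subset B ->
  connect (within e A) x y -> connect (within e' B) x y.
Proof.
move=> ee' /subsetP AB; apply: connect_sub => u v /and3P[uA vA euv].
by apply: connect1; rewrite /within /= !AB // ee'.
Qed.

Lemma path_within e A x p :
  path e x p -> all (mem A) (x :: p) -> path (within e A) x p.
Proof.
elim: p x => //= z p IH x /andP[exz pzp] /and3P[xA zA pA].
by rewrite /within /= in IH *; rewrite xA zA exz IH //= zA.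
Qed.

Lemma path_connect_within e A x p z :
  path e x p -> all (mem A) (x :: p) -> z \in x :: p ->
  connect (within e A) x z.
Proof. by move=> pp pA; move: z; apply: path_connect (path_within pp pA). Qed.

Lemma path_within_all e A x p :
  path (within e A) x p -> all (mem A) p && path e x p.
Proof.
by elim: p x => //= z p IH x /andP[/and3P[_ -> ->] /IH].
Qed.

Lemma nonseparable_conn e A : nonseparable e A -> conn e A.
Proof.
by move/nonseparableP/(_ set0); rewrite cards0 setD0 => /(_ isT).
Qed.

Lemma nonseparable_mono e e' A :
  (forall u v, u \in A -> v \in A -> e u v -> e' u v) ->
  nonseparable e A -> nonseparable e' A.
Proof.
move=> ee' /nonseparableP ns; apply/nonseparableP => S /ns/connP cS.
apply/connP => x y xA yA; apply: connect_within_mono (cS x y xA yA) => // u v.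
by rewrite !inE => /andP[_ uA] /andP[_ vA]; apply: ee'.
Qed.

Lemma nonseparable_edge e a b :
  symmetric e -> e a b -> nonseparable e [set a; b].
Proof.
move=> esym eab; apply/nonseparableP => S _; apply/connP => u v uD vD.
have [-> | neq] := eqVneq u v; first exact: connect0.
apply: connect1; rewrite /within /= uD vD /=.
move: uD vD neq; rewrite !inE => /andP[_ /orP[]/eqP->] /andP[_ /orP[]/eqP->];
  by rewrite ?eqxx // esym.
Qed.

Lemma colorsP e c A i :
  reflect (exists u v, [/\ u \in A, v \in A, e u v & i = c u v])
          (i \in colors e c A).
Proof.
apply: (iffP imageP) => [[[u v] /and3P[uA vA euv] ->] | [u [v [uA vA euv ->]]]].
  by exists u, v.
by exists (u, v) => //; apply/and3P.
Qed.

Lemma earP e A H x s y :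
  reflect ([/\ x \in H, y \in H, x != y, s != [::] & path e x (rcons s y)] /\
           {in s, forall z, z \in A /\ z \notin H})
          (ear e A H x s y).
Proof.
apply: (iffP and5P) => [[xH yH xy s0 /andP[ps /allP sA]] | [[xH yH xy s0 ps] sA]].
  by split=> // z /sA; rewrite /= !inE => /andP[].
split=> //; rewrite ps; apply/allP => z /sA[zA zH].
by rewrite /= inE zH.
Qed.

(** * Ears *)

Lemma ear_rev e A H x s y :
  symmetric e -> ear e A H x s y -> ear e A H y (rev s) x.
Proof.
move=> esym /earP[[xH yH xy s0 ps] sA]; apply/earP; split; last first.
  by move=> z; rewrite mem_rev; apply: sA.
have s0' : rev s != [::] by rewrite -size_eq0 size_rev size_eq0.
split=> //; first by rewrite eq_sym.
have := rev_path e x (rcons s y); rewrite last_rcons belast_rcons rev_cons => ->.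
by rewrite (eq_path (e' := e)) // => u v; rewrite esym.
Qed.

Lemma connect_crossing (r : rel V) H x y :
  connect r x y -> x \in H -> y \notin H ->
  exists u w, [/\ u \in H, w \notin H & r u w].
Proof.
case/connectP=> p; elim: p x => [|z p IH] x /=; first by move=> _ -> ->.
case/andP=> rxz pzp lastp xH yH; have [zH | zH] := boolP (z \in H).
  exact: IH pzp lastp zH yH.
by exists x, z.
Qed.

Lemma first_entry (r : rel V) H w p :
  path r w p -> w \notin H -> last w p \in H ->
  exists s y, [/\ path r w (rcons s y), y \in H & all [predC H] (w :: s)].
Proof.
elim: p w => [|z p IH] w /=; first by move=> _ /negPf->.
case/andP=> rwz pzp wH; have [zH _ | zH lastH] := boolP (z \in H).
  by exists [::], z; rewrite /= rwz wH.
have [s [y [psy yH /= sH]]] := IH z pzp zH lastH.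
by exists (z :: s), y; rewrite /= rwz wH.
Qed.

(** An edge x w leaves H by connectedness; deleting x leaves w connected to the
    rest of H, and the first return to H is at an end different from x. *)
Lemma ear_exists e A H :
  symmetric e -> nonseparable e A -> H \proper A -> 1 < #|H| ->
  exists x s y, ear e A H x s y.
Proof.
move=> esym ns /properP[/subsetP HA [v vA vH]] H2.
have /card_gt0P[h hH] : 0 < #|H| by apply: ltnW.
have /connP/(_ h v (HA h hH) vA) hv := nonseparable_conn ns.
have [x [w [xH wH /and3P[xA wA exw]]]] := connect_crossing hv hH vH.
have /card_gt0P[h'] : 0 < #|H :\ x| by move: H2; rewrite (cardsD1 x) xH.
rewrite !inE => /andP[h'x h'H].
have wx : w != x by apply: contraNneq wH => ->.
have /nonseparableP/(_ [set x]) := ns; rewrite cards1 => /(_ isT)/connP/(_ w h').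
rewrite !inE h'x wx wA HA // => /(_ isT isT)/connectP[p pwp h'_def].
rewrite h'_def in h'H; have [s [y [psy yH sH]]] := first_entry pwp wH h'H.
have /andP[/allP sA pe] := path_within_all psy.
have yx : y != x.
  by have := sA y; rewrite mem_rcons inE eqxx => /(_ isT); rewrite !inE => /andP[].
exists x, (w :: s), y; apply/earP; split; last first.
  move=> z zs; split; last exact: (allP sH).
  move: zs; rewrite inE => /predU1P[-> // | zs].
  by have := sA z; rewrite mem_rcons inE zs orbT => /(_ isT); rewrite !inE => /andP[].
by split=> //=; rewrite ?exw // eq_sym.
Qed.

(** A vertex z of s cuts the ear into a part towards x and a part towards y. The
    deletion of one vertex other than z spares one of the two parts, along which
    z still reaches what remains of H, and that is connected. *)
Lemma ear_nonseparable e A H x s y :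
  symmetric e -> nonseparable e H -> ear e A H x s y -> uniq s ->
  nonseparable e (H :|: [set:: s]).
Proof.
move=> esym /nonseparableP nsH /earP[[xH yH xy _ ps] sA] us.
apply/nonseparableP => S S2; set D := (_ :|: _) :\: S.
have HD : H :\: S \subset D by apply/setSD/subsetUl.
have hub z : z \in D -> exists2 h, h \in H :\: S & connect (within e D) z h.
  rewrite !inE => /andP[zS /orP[zH | zs]].
    by exists z; rewrite ?connect0 // inE zS.
  have uall : uniq (x :: rcons s y).
    rewrite /= mem_rcons inE negb_or xy rcons_uniq us andbT.
    by apply/andP; split; apply/negP => /sA[_]; rewrite ?xH ?yH.
  have inD u : (u \in x :: rcons s y) -> (u \notin S) -> u \in D.
    rewrite inE mem_rcons inE => uxsy uS; rewrite !inE uS /=.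
    by case/or3P: uxsy => [/eqP->|/eqP->|->]; rewrite ?xH ?yH ?orbT.
  case/splitPr: zs ps uall inD => s1 s2; rewrite rcons_cat rcons_cons => ps uall inD.
  move: (ps); rewrite -cat_rcons cat_path last_rcons => /andP[p1 p2].
  have [/hasP[v v1 /= vS] | hasN] := boolP (has (mem S) (x :: s1)).
    have S1 w : w \in S -> w = v.
      move=> wS; apply/eqP; apply: contraTT S2 => wv.
      rewrite -leqNgt (cardsD1 v) vS (cardsD1 w) !inE wv wS //.
    have tailS w : w \in z :: rcons s2 y -> w \notin S.
      move=> w2; apply/negP => /S1 wv; move: uall.
      rewrite -cat_cons cat_uniq => /and3P[_ /hasP[]].
      by exists w => //; rewrite /= wv.
    exists y.
      by rewrite inE yH tailS // inE mem_rcons inE eqxx orbT.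
    apply: path_connect_within p2 _ _; last by rewrite inE mem_rcons inE eqxx orbT.
    apply/allP => w w2; apply: inD (tailS w w2).
    by rewrite inE mem_cat w2 !orbT.
  have /hasPn headS := hasN.
  exists x; first by rewrite inE xH andbT; apply: headS (mem_head x s1).
  have xz_D : all (mem D) (x :: rcons s1 z).
    apply/allP => w; rewrite -rcons_cons mem_rcons inE => /predU1P[->|w1].
      by apply: inD zS; rewrite -cat_cons mem_cat mem_head orbT.
    by apply: inD (headS w w1); rewrite -cat_cons mem_cat w1.
  rewrite connect_within_sym //; apply: path_connect_within p1 xz_D _.
  by rewrite inE mem_rcons mem_head orbT.
apply/connP => u v /hub[h hH uh] /hub[k kH vk].
apply: connect_trans uh _; rewrite connect_within_sym //.
apply: connect_trans vk _; have /connP/(_ k h kH hH) := nsH S S2.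
exact: connect_within_mono.
Qed.

(** * Shortest ears *)

Section ShortestEar.
Variables (e : rel V) (A H : {set V}).

Definition shortest_ear x s y :=
  ear e A H x s y /\
  forall x' s' y', ear e A H x' s' y' -> size s <= size s'.

Lemma shortest_ear_uniq x s y : shortest_ear x s y -> uniq s.
Proof.
case=> E shortest.
apply: contraT => /uniqPn-/(_ x)[i [j [ij js nth_ij]]].
have := E => /earP[[xH yH xy s0 ps] sA].
pose s' := take i s ++ drop j s.
have {}js : j < size s := js.
have s'_lt : size s' < size s.
  by rewrite size_cat size_drop size_takel; move: ij js; lia.
suff /shortest : ear e A H x s' y by rewrite leqNgt s'_lt.
apply/earP; split; last first.
  by move=> z; rewrite mem_cat => /orP[/mem_take|/mem_drop]; apply: sA.
split=> //.
  have : 0 < size s' by rewrite size_cat size_drop; move: js; lia.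
  by case: (s').
move: ps; rewrite -{1}(cat_take_drop i s) /s' !rcons_cat !cat_path.
case/andP=> -> /=; rewrite (drop_nth x) ?(ltn_trans ij) //.
rewrite [in X in _ -> X](drop_nth x) // /= nth_ij => /andP[-> /=].
have -> : drop i.+1 s = take (j - i.+1) (drop i.+1 s) ++ drop j s.
  by rewrite -{1}(cat_take_drop (j - i.+1) (drop i.+1 s)) drop_drop subnK.
rewrite rcons_cat cat_path => /andP[_].
by rewrite (drop_nth x js) /= => /andP[].
Qed.

Lemma shortest_ear_chordless x s y s1 a s2 b s3 :
  shortest_ear x s y -> s = s1 ++ a :: s2 ++ b :: s3 -> e a b -> s2 = [::].
Proof.
case=> E shortest s_def eab; apply/eqP; rewrite -size_eq0 eqn0Ngt; apply/negP => s2_gt0.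
have := E => /earP[[xH yH xy s0 ps] sA].
suff /shortest : ear e A H x (s1 ++ a :: b :: s3) y.
  by move: s2_gt0; rewrite s_def !size_cat /= size_cat /=; lia.
apply/earP; split; last first.
  move=> z z_s; apply: sA; move: z_s; rewrite s_def !(mem_cat, inE).
  by case/or4P=> ->; rewrite ?orbT.
split=> //; first by case: (s1).
move: ps; rewrite s_def !(rcons_cat, rcons_cons, cat_path) /= cat_path /=.
by case/and5P=> -> -> _ _ ->; rewrite eab.
Qed.

(** Another neighbor z of a would close the ear x, ..., a, z earlier. *)
Lemma ear_neighbor_first x s y s1 a s2 z :
  shortest_ear x s y -> s = s1 ++ a :: s2 -> s2 != [::] -> z \in H -> e a z -> z = x.
Proof.
case=> E shortest s_def s2_0 zH eaz; apply/eqP; apply: contraT => zx.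
have := E => /earP[[xH yH xy s0 ps] sA].
suff /shortest : ear e A H x (rcons s1 a) z.
  by rewrite s_def size_cat size_rcons /=; case: (s2) s2_0 => //= *; lia.
apply/earP; split; last first.
  move=> w w_s; apply: sA; move: w_s; rewrite s_def mem_rcons !(mem_cat, inE).
  by case/orP=> ->; rewrite ?orbT.
split; rewrite 1?eq_sym //; first by case: (s1).
move: ps; rewrite s_def rcons_cat cat_path /= => /and3P[ps1 ea _].
by rewrite !rcons_path last_rcons ps1 ea.
Qed.

Lemma shortest_ear_rev x s y :
  symmetric e -> shortest_ear x s y -> shortest_ear y (rev s) x.
Proof.
by move=> esym [E shortest]; split; [exact: ear_rev | rewrite size_rev].
Qed.

Lemma ear_neighbor_last x s y s1 a s2 z :
  symmetric e -> shortest_ear x s y -> s = s1 ++ a :: s2 -> s1 != [::] -> z \in H -> e a z ->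
  z = y.
Proof.
move=> esym /(shortest_ear_rev esym) SE s_def s1_0.
apply: (ear_neighbor_first SE (s1 := rev s2) (s2 := rev s1)).
  by rewrite s_def rev_cat rev_cons cat_rcons.
by rewrite -size_eq0 size_rev size_eq0.
Qed.

(** Every second vertex of a segment r of the ear can be added, as r induces a
    path. *)
Lemma extend_independent x s y s1 r s2 (I : {set V}) :
  symmetric e -> irreflexive e -> H \subset A ->
  shortest_ear x s y -> s = s1 ++ r ++ s2 -> I \subset H ->
  {in I &, forall a b, ~~ e a b} ->
  {in r & I, forall a z, ~~ e a z} ->
  exists J : {set V}, [/\ J \subset A, {in J &, forall a b, ~~ e a b}
                       & #|J| = #|I| + uphalf (size r)].
Proof.
move=> esym eirr HA SE s_def IH indI rI.
have us := shortest_ear_uniq SE.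
have [/earP[_ sA] _] := SE.
have alt_r a : a \in alternate r -> a \in r.
  exact: (mem_subseq (alternate_subseq r)).
have r_s a : a \in r -> a \in s by rewrite s_def !mem_cat => ->; rewrite orbT.
have indR : {in alternate r &, forall a b, ~~ e a b}.
  apply: alternate_independent => // t1 a t2 b t3 r_def.
  apply: (shortest_ear_chordless SE (s1 := s1 ++ t1) (s3 := t3 ++ s2)).
  by rewrite s_def r_def -!catA /= -catA.
exists (I :|: [set:: alternate r]); split.
- rewrite subUset (subset_trans IH HA); apply/subsetP => a.
  by rewrite inE => /alt_r/r_s/sA[].
- move=> a b; rewrite !inE => /orP[aI | ar] /orP[bI | br].
  + exact: indI.
  + by rewrite esym; apply: rI => //; apply: alt_r.
  + by apply: rI => //; apply: alt_r.
  + exact: indR.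
rewrite cardsU; have -> : I :&: [set:: alternate r] = set0.
  apply/setP => a; rewrite !inE; apply/negP => /andP[aI /alt_r/r_s/sA[_]].
  by rewrite (subsetP IH).
rewrite cards0 subn0; congr (_ + _); rewrite -size_alternate.
have ua : uniq (alternate r).
  apply: subseq_uniq (alternate_subseq r) _.
  by move: us; rewrite s_def !cat_uniq => /and3P[_ _ /andP[]].
by rewrite -(card_uniqP ua); apply: eq_card => a; rewrite inE.
Qed.

(** The inner vertices of s other than its two ends have no neighbor in H at
    all. *)
Lemma extend_independent_long x s y m (I : {set V}) :
  symmetric e -> irreflexive e -> H \subset A -> shortest_ear x s y ->
  2 * m < size s -> I \subset H -> {in I &, forall a b, ~~ e a b} ->
  exists J : {set V}, [/\ J \subset A, {in J &, forall a b, ~~ e a b}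
                       & #|I| + m <= #|J|].
Proof.
move=> esym eirr HA SE lt_m IH indI.
have [/earP[[_ _ xy _ _] _] _] := SE.
have [s1 [r [s2 [s_def s1_0 s2_0 size_r]]]] := inner_segment lt_m.
have rI : {in r & I, forall a z, ~~ e a z}.
  move=> w z wr zI; apply/negP => ewz; have zH := subsetP IH z zI.
  have r0 : r != [::] by case: (r) wr.
  have [r1 [r2 r_def]] := mem_split wr; rewrite {}r_def in s_def s1_0 s2_0 r0.
  have zy : z = y.
    apply: (ear_neighbor_last esym SE (s1 := s1 ++ r1) (s2 := r2 ++ s2) _ _ zH ewz).
      by rewrite s_def -!catA.
    by case: (s1) s1_0 => // /(_ r0).
  have zx : z = x.
    apply: (ear_neighbor_first SE (s1 := s1 ++ r1) (s2 := r2 ++ s2) _ _ zH ewz).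
      by rewrite s_def -!catA.
    by case: (s2) s2_0 => [/(_ r0)|] //; case: (r2).
  by rewrite -zx zy eqxx in xy.
have [J [JA indJ cardJ]] := extend_independent esym eirr HA SE s_def IH indI rI.
by exists J; split=> //; rewrite cardJ leq_add2l.
Qed.

(** Without its last vertex, s sees nothing of H but x, and it has an odd number
    2m - 1 of vertices, m of which are at odd positions. *)
Lemma extend_independent_short x s y m (I : {set V}) :
  symmetric e -> irreflexive e -> H \subset A -> shortest_ear x s y ->
  size s = 2 * m -> I \subset H -> {in I &, forall a b, ~~ e a b} ->
  x \notin I ->
  exists J : {set V}, [/\ J \subset A, {in J &, forall a b, ~~ e a b}
                       & #|I| + m <= #|J|].
Proof.
move=> esym eirr HA SE sz IH indI xI.
have [/earP[[_ _ _ s0 _] _] _] := SE.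
case/lastP: s s0 SE sz => [|r l] // _ SE sz.
have rI : {in r & I, forall a z, ~~ e a z}.
  move=> w z /mem_split[r1 [r2 r_def]] zI; apply: contra xI => ewz.
  rewrite -(ear_neighbor_first SE (s1 := r1) (s2 := rcons r2 l)
             _ _ (subsetP IH z zI) ewz) //.
    by rewrite r_def rcons_cat.
  by case: (r2).
have r_def : rcons r l = [::] ++ r ++ [:: l] by rewrite cats1.
have [J [JA indJ cardJ]] := extend_independent esym eirr HA SE r_def IH indI rI.
exists J; split=> //; rewrite cardJ leq_add2l.
by apply: leq_uphalf; rewrite -sz size_rcons.
Qed.

End ShortestEar.

(** * Colors on an ear *)

Lemma path_avoid e c i x p :
  path e x p -> i \notin pairmap c x p -> path (avoid e c i) x p.
Proof.
elim: p x => //= z p IH x /andP[exz pzp]; rewrite inE negb_or => /andP[ci ip].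
by rewrite IH // andbT; apply/andP; split; rewrite // eq_sym.
Qed.

Lemma pairmap_split c x p i :
  i \in pairmap c x p ->
  exists p1 z p2, p = p1 ++ z :: p2 /\ c (last x p1) z = i.
Proof.
elim: p x => //= z p IH x; rewrite inE => /predU1P[-> | /IH[p1 [w [p2 [-> <-]]]]].
  by exists [::], z, p.
by exists (z :: p1), w, p2.
Qed.

Lemma connect_avoid_new e c A H i :
  H \subset A -> conn e H -> i \notin colors e c H ->
  {in H &, forall x y, connect (within (avoid e c i) A) x y}.
Proof.
move=> HA /connP cH iH x y xH yH; apply: connect_within_mono (cH x y xH yH) => //.
move=> u v uH vH euv; rewrite /avoid /= euv /=; apply: contra iH => /eqP <-.
by apply/colorsP; exists u, v.
Qed.

Lemma separated_sub e c A H :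
  H \subset A -> separated e c A -> separated e c H.
Proof.
move=> HA sep x y xH yH xy; have /subsetP HA' := HA.
have [i ni] := sep x y (HA' x xH) (HA' y yH) xy.
by exists i; apply: contra ni; apply: connect_within_mono.
Qed.

Lemma separated_edge e c A u v i :
  u \in A -> v \in A -> e u v ->
  ~~ connect (within (avoid e c i) A) u v -> c u v = i.
Proof.
move=> uA vA euv; apply: contraNeq => ci; apply: connect1.
by rewrite /within /avoid /= uA vA euv.
Qed.

Section ColoredEar.
Variables (e : rel V) (c : V -> V -> nat) (A H : {set V}).
Hypotheses (esym : symmetric e) (eirr : irreflexive e).
Hypothesis csym : forall u v, c u v = c v u.
Hypotheses (HA : H \subset A) (cH : conn e H) (sep : separated e c A).

Lemma ear_sub x s y : ear e A H x s y -> all (mem A) (x :: rcons s y).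
Proof.
case/earP=> -[xH yH _ _ _] sA; have /subsetP HA' := HA.
apply/allP => z; rewrite inE mem_rcons inE => /or3P[/eqP->|/eqP->|/sA[]//];
  exact: HA'.
Qed.

(** A color separating x from y in A has to cut both the ear and every path in
    H. *)
Lemma ear_old_color x s y : ear e A H x s y ->
  exists i, [/\ i \in colors e c H, i \in pairmap c x (rcons s y)
              & ~~ connect (within (avoid e c i) A) x y].
Proof.
move=> E; have sA := ear_sub E; case/earP: E => -[xH yH xy _ ps] _.
have /subsetP HA' := HA.
have [i ni] := sep (HA' x xH) (HA' y yH) xy; exists i; split=> //.
  by apply: contraR ni => iH; apply: connect_avoid_new iH _ _ xH yH.
apply: contraR ni => iL; apply: path_connect_within (path_avoid ps iL) sA _.
by rewrite inE mem_rcons mem_head orbT.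
Qed.

(** If i occurred only once, its edge would have its ends joined by the rest of
    the ear and a path in H, all avoiding i; but an edge of color i can be
    separated in color i only. *)
Lemma ear_new_color x s y i : ear e A H x s y ->
  i \notin colors e c H -> i \in pairmap c x (rcons s y) ->
  1 < count_mem i (pairmap c x (rcons s y)).
Proof.
move=> E iH iL; have sA := ear_sub E; case/earP: E => -[xH yH xy _ ps] _.
have [p1 [z [p2 [p_def ci]]]] := pairmap_split iL.
have last_p : last z p2 = y by rewrite -(last_rcons x s y) p_def last_cat.
rewrite {}p_def in ps sA iL *.
move: ps sA; rewrite cat_path -cat_cons all_cat => /= /and3P[ps1 euz ps2].
move=> /andP[sA1 sA2]; have {}sA1 : all (mem A) (x :: p1) := sA1.
have {}sA2 : all (mem A) (z :: p2) := sA2.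
rewrite pairmap_cat count_cat /= ci eqxx addnCA add1n ltnS.
set u := last x p1 in euz ps2 ci *.
have uA : u \in A by apply: (allP sA1); apply: mem_last.
have zA : z \in A by case/andP: sA2.
rewrite lt0n addn_eq0 !eqn0Ngt -!has_count !has_pred1.
apply/negP => /andP[i1 i2]; have uz : u != z.
  by apply: contraTneq euz => ->; rewrite eirr.
have [j nj] := sep uA zA uz.
have ij : i = j by rewrite -ci; apply: separated_edge nj.
move/negP: nj; apply; rewrite -{}ij.
have avsym := @avoid_sym e c i esym csym.
apply: connect_trans (_ : connect _ x z).
  rewrite connect_within_sym //.
  by apply: path_connect_within (path_avoid ps1 i1) sA1 _; apply: mem_last.
apply: connect_trans (connect_avoid_new HA cH iH xH yH) _.
rewrite connect_within_sym // -last_p.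
by apply: path_connect_within (path_avoid ps2 i2) sA2 _; apply: mem_last.
Qed.

Definition new_colors x s y :=
  undup [seq i <- pairmap c x (rcons s y) | i \notin colors e c H].

Lemma double_new_colors_le_count x s y :
  ear e A H x s y ->
  2 * size (new_colors x s y)
    <= count (predC (mem (colors e c H))) (pairmap c x (rcons s y)).
Proof.
move=> E; rewrite -size_filter; apply: double_size_undup_le => j.
rewrite mem_filter => /andP[jH jL].
rewrite count_filter (eq_count (a2 := pred1 j)); first exact: ear_new_color.
by move=> k /=; case: eqP => // ->.
Qed.

Lemma count_old_new x s y :
  count (mem (colors e c H)) (pairmap c x (rcons s y)) +
  count (predC (mem (colors e c H))) (pairmap c x (rcons s y)) = (size s).+1.
Proof. by rewrite count_predC size_pairmap size_rcons. Qed.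

Lemma double_new_colors_le x s y :
  ear e A H x s y -> 2 * size (new_colors x s y) <= size s.
Proof.
move=> E; have [i [iH iL _]] := ear_old_color E.
have : 0 < count (mem (colors e c H)) (pairmap c x (rcons s y)).
  by rewrite -has_count; apply/hasP; exists i.
have := double_new_colors_le_count E; have := count_old_new x s y.
lia.
Qed.

(** All but one of the |s| + 1 edges of the ear carry new colors. *)
Lemma old_color_unique x s y j k :
  ear e A H x s y -> size s = 2 * size (new_colors x s y) ->
  j \in colors e c H -> j \in pairmap c x (rcons s y) ->
  k \in colors e c H -> k \in pairmap c x (rcons s y) -> j = k.
Proof.
move=> E sz; set L := pairmap c x (rcons s y) => jH jL kH kL.
have : size (filter (mem (colors e c H)) L) <= 1.
  rewrite size_filter; have := double_new_colors_le_count E.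
  have := count_old_new x s y; rewrite -/L; lia.
have : j \in filter (mem (colors e c H)) L by rewrite mem_filter /= jH.
have : k \in filter (mem (colors e c H)) L by rewrite mem_filter /= kH.
by case: (filter _ L) => [|l [|]] //; rewrite !inE => /eqP-> /eqP->.
Qed.

Definition add_edge x y : rel V :=
  [rel u v | [|| e u v, (u == x) && (v == y) | (u == y) && (v == x)]].

(** An existing edge keeps its color, so that adding an edge that is already
    present changes nothing. *)
Definition extend_coloring (i : nat) u v : nat := if e u v then c u v else i.

(** A color j separating u from v in A still does so in H with the new edge. If
    j is i, the new edge is cut as well. Otherwise j, if it is old, is absent
    from the ear, so the ear stands in for the new edge; and a new color j never
    separates vertices of H. *)
Lemma chord_separated x s y i :
  ear e A H x s y -> ~~ connect (within (avoid e c i) A) x y ->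
  (forall j, j \in colors e c H -> j \in pairmap c x (rcons s y) -> j = i) ->
  separated (add_edge x y) (extend_coloring i) H.
Proof.
move=> E ni old_i u v uH vH uv; have /subsetP HA' := HA.
have [j nj] := sep (HA' u uH) (HA' v vH) uv; exists j; apply: contra nj.
have avsym := @avoid_sym e c j esym csym.
have xyj : i != j -> connect (within (avoid e c j) A) x y.
  move=> ij; have sA := ear_sub E; case/earP: E => -[xH yH _ _ ps] _.
  have [jH | jH] := boolP (j \in colors e c H); last first.
    exact: (connect_avoid_new HA cH jH xH yH).
  have jL : j \notin pairmap c x (rcons s y).
    by apply/negP => jL; rewrite (old_i j jH jL) eqxx in ij.
  apply: path_connect_within (path_avoid ps jL) sA _.
  by rewrite inE mem_rcons mem_head orbT.
apply: connect_sub => a b /and3P[aH bH /andP[]].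
rewrite /add_edge /extend_coloring /=; case: ifPn => [eab _ cj | _ /= ab /xyj xy].
  by apply: connect1; rewrite /within /avoid /= !HA' // eab.
case/orP: ab => /andP[/eqP-> /eqP->] //.
by rewrite connect_within_sym.
Qed.

(** If s has several vertices, the edge az is an end edge of the ear. If a is the
    only one, az belongs to another ear of length two through a, and such an ear
    is too short to carry a new color. *)
Lemma ear_edge_color x s y a z :
  shortest_ear e A H x s y -> a \in s -> z \in H -> e a z ->
  (c a z \in colors e c H) || (c a z \in pairmap c x (rcons s y)).
Proof.
move=> SE a_s zH eaz; have [E shortest] := SE.
have := E => /earP[[xH yH xy s0 ps] sA].
have [s1 [s2 s_def]] := mem_split a_s.
have [s1_0 | s1_0] := eqVneq s1 [::]; last first.
  have zy := ear_neighbor_last esym SE s_def s1_0 zH eaz.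
  have [s2_0 | s2_0] := eqVneq s2 [::].
    rewrite s_def s2_0 zy -cats1 -catA pairmap_cat mem_cat /= !inE eqxx.
    by rewrite !orbT.
  have zx := ear_neighbor_first SE s_def s2_0 zH eaz.
  by rewrite -zx zy eqxx in xy.
rewrite {}s1_0 /= in s_def; have [s2_0 | s2_0] := eqVneq s2 [::]; last first.
  have zx := ear_neighbor_first SE (s_def : s = [::] ++ _) s2_0 zH eaz.
  by rewrite s_def zx csym /= inE eqxx orbT.
rewrite {}s2_0 in s_def; subst s; have [aA aH] := sA a (mem_head _ _).
(* Of the two ends of the given ear, one differs from z. *)
have [w [wH wz eaw]] : exists w, [/\ w \in H, z != w & e a w].
  move: ps => /= /and3P[exa eay _]; have [zy | zy] := eqVneq z y.
    by exists x; rewrite zy eq_sym esym.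
  by exists y.
have E' : ear e A H z [:: a] w.
  apply/earP; split; first by rewrite /= esym eaz eaw.
  by move=> u; rewrite inE => /eqP->.
have := double_new_colors_le E'; apply: contraLR; rewrite negb_or => /andP[].
move=> cH' _; suff : c z a \in new_colors z [:: a] w.
  case: (new_colors z [:: a] w) => // j N _.
  by rewrite -ltnNge /= mulnS.
by rewrite /new_colors mem_undup mem_filter csym cH' /= inE csym eqxx.
Qed.

Lemma colors_shortest_ear x s y :
  shortest_ear e A H x s y -> A = H :|: [set:: s] ->
  {subset colors e c A <= undup (colors e c H) ++ new_colors x s y}.
Proof.
move=> SE A_def i i_A; have [E shortest] := SE.
suff /orP[iH | iL] : (i \in colors e c H) || (i \in pairmap c x (rcons s y)).
- by rewrite mem_cat mem_undup iH.
- rewrite mem_cat !mem_undup mem_filter iL andbT.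
  by case: (i \in colors e c H).
case/colorsP: i_A => u [v [uA vA euv ->]]; move: uA vA.
rewrite A_def !inE => /orP[uH | us] /orP[vH | vs].
- by apply/orP; left; apply/colorsP; exists u, v.
- by rewrite csym; apply: (ear_edge_color SE) => //; rewrite esym.
- exact: (ear_edge_color SE).
apply/orP; right; have := E => /earP[[xH yH xy s0 ps] sA].
have consecutive w w' s1 s2 : s = s1 ++ w :: s2 -> w' \in s2 -> e w w' ->
    c w w' \in pairmap c x (rcons s y).
  move=> s_def /mem_split[s3 [s4 s2_def]] eww'; rewrite s2_def in s_def.
  have s3_0 := shortest_ear_chordless SE s_def eww'.
  by rewrite s_def s3_0 rcons_cat pairmap_cat mem_cat /= !inE eqxx !orbT.
have [s1 [s2 s_def]] := mem_split us.
have : v \in s1 ++ u :: s2 by rewrite -s_def.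
rewrite mem_cat inE => /or3P[v1 | /eqP vu | v2].
- case/splitPr: v1 s_def => s3 s4; rewrite -catA => s_def.
  rewrite csym; apply: (consecutive _ _ _ _ s_def); last by rewrite esym.
  by rewrite mem_cat mem_head orbT.
- by rewrite vu eirr in euv.
- exact: (consecutive _ _ _ _ s_def).
Qed.

End ColoredEar.

(** * The bound *)

Lemma shortest_ear_exists e A H :
  symmetric e -> nonseparable e A -> H \proper A -> 1 < #|H| ->
  exists x s y, shortest_ear e A H x s y.
Proof.
move=> esym ns HA H2; have [x [s [y E]]] := ear_exists esym ns HA H2.
pose P n := [exists x, exists y, exists t : n.-tuple V, ear e A H x t y].
have exP x' s' y' : ear e A H x' s' y' -> P (size s').
  move=> E'; apply/existsP; exists x'; apply/existsP; exists y'.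
  by apply/existsP; exists (in_tuple s').
have exn : exists n, P n by exists (size s); apply: exP E.
case: (ex_minnP exn) => n /existsP[x0 /existsP[y0 /existsP[t Et]]] min_n.
by exists x0, t, y0; split=> // x' s' y' /exP/min_n; rewrite size_tuple.
Qed.

Lemma maximal_nonseparable e A a b :
  symmetric e -> irreflexive e -> a \in A -> b \in A -> e a b ->
  A != [set a; b] ->
  exists H, [/\ H \proper A, 1 < #|H|, nonseparable e H
    & forall H', nonseparable e H' -> H' \subset A -> H \proper H' -> H' = A].
Proof.
move=> esym eirr aA bA eab Aab.
pose P H := [&& H \proper A, 1 < #|H| & nonseparable e H].
have ab : a != b by apply: contraTneq eab => ->; rewrite eirr.
have Pab : P [set a; b].
  rewrite /P nonseparable_edge // cards2 ab properEneq eq_sym Aab /= andbT.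
  by rewrite subUset !sub1set aA.
have [H /and3P[HA H2 nsH] maxH] := @arg_maxnP _ [set a; b] P (fun H => #|H|) Pab.
exists H; split=> // H' nsH' H'A HH'; apply/eqP; apply: contraT => neq.
have : P H'.
  rewrite /P nsH' properEneq neq H'A /= andbT.
  exact: leq_trans H2 (subset_leq_card (proper_sub HH')).
by move/maxH => /= le_H'; have := proper_card HH'; rewrite ltnNge le_H'.
Qed.

Lemma colors_le_independent n e c A :
  symmetric e -> irreflexive e -> (forall u v, c u v = c v u) ->
  #|A| < n -> nonseparable e A -> separated e c A ->
  exists I : {set V}, [/\ I \subset A, {in I &, forall a b, ~~ e a b}
                       & size (undup (colors e c A)) <= #|I|].
Proof.
elim: n e c A => // n IHn e c A esym eirr csym ltAn ns sep.
have [[a b] /= /and3P[aA bA eab] | noedge] :=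
  pickP [pred q : V * V | within e A q.1 q.2]; last first.
  exists set0; split; [exact: sub0set | by move=> u v; rewrite inE |].
  rewrite cards0 leqn0 size_eq0; case C: (colors e c A) => [|i l] //.
  have : i \in colors e c A by rewrite C mem_head.
  case/colorsP=> u [v [uA vA euv _]]; have := noedge (u, v).
  by rewrite /= /within /= uA vA euv.
have [A_ab | A_ab] := eqVneq A [set a; b].
  exists [set a]; split; first by rewrite sub1set.
    by move=> u v; rewrite !inE => /eqP-> /eqP->; rewrite eirr.
  rewrite cards1 -[1]/(size [:: c a b]); apply: uniq_leq_size (undup_uniq _) _.
  move=> i; rewrite mem_undup => /colorsP[u [v [+ + euv ->]]].
  rewrite A_ab !inE => /orP[]/eqP u_def /orP[]/eqP v_def;
    by move: euv; rewrite u_def v_def ?eirr // csym.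
have [H [HA H2 nsH maxH]] := maximal_nonseparable esym eirr aA bA eab A_ab.
have HsubA := proper_sub HA; have cH := nonseparable_conn nsH.
have [x [s [y SE]]] := shortest_ear_exists esym ns HA H2.
have [E shortest] := SE; have [[xH yH xy s0 ps] sA] := earP _ _ _ _ _ _ E.
have A_def : A = H :|: [set:: s].
  symmetry; apply: maxH.
  - exact: ear_nonseparable esym nsH E (shortest_ear_uniq SE).
  - rewrite subUset HsubA; apply/subsetP => z.
    by rewrite inE => /sA[].
  rewrite properE subsetUl /=; apply/subsetPn.
  case: s s0 sA {ps E SE shortest} => // z s _ sA; exists z.
    by rewrite !inE eqxx orbT.
  by have [] := sA z (mem_head _ _).
have ltHn : #|H| < n by apply: leq_trans (proper_card HA) _.
have sepH := separated_sub HsubA sep.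
pose m := size (new_colors e c H x s y).
have le_m : 2 * m <= size s by apply: double_new_colors_le (E).
have bound (J : {set V}) k :
    size (undup (colors e c H)) <= k -> k + m <= #|J| ->
    size (undup (colors e c A)) <= #|J|.
  move=> le_k; apply: leq_trans.
  apply: leq_trans (_ : size (undup (colors e c H) ++ new_colors e c H x s y) <= _).
    apply: uniq_leq_size (undup_uniq _) _ => i; rewrite mem_undup.
    exact: colors_shortest_ear.
  by rewrite size_cat leq_add2r.
have [size_s | size_s] := eqVneq (size s) (2 * m); last first.
  have [I [IH indI le_I]] := IHn e c H esym eirr csym ltHn nsH sepH.
  have lt_m : 2 * m < size s by rewrite ltn_neqAle eq_sym size_s.
  have [J [JA indJ le_J]] := extend_independent_long esym eirr HsubA SE lt_m IH indI.
  by exists J; split=> //; apply: bound le_I le_J.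
(* The ear has one edge of an old colour and 2m edges of m new colours: trade
   the whole ear for the edge xy in that old colour, so that the inductive set
   cannot contain both ends. *)
have [i [iH iL ni]] := ear_old_color HsubA cH sep E.
have old_i j (jH : j \in colors e c H) (jL : j \in pairmap c x (rcons s y)) : j = i.
  exact: (old_color_unique esym eirr csym HsubA cH sep E size_s).
pose e' := add_edge e x y; pose c' := extend_coloring e c i.
have e'sym : symmetric e'.
  move=> u v; rewrite /e' /add_edge /= esym; congr (_ || _).
  by rewrite orbC ![(v == _) && _]andbC.
have e'irr : irreflexive e'.
  move=> u; rewrite /e' /add_edge /= eirr /=.
  by apply/norP; split; apply: contra xy => /andP[/eqP <- /eqP <-].
have c'sym u v : c' u v = c' v u by rewrite /c' /extend_coloring esym csym.
have ee' u v : e u v -> e' u v by rewrite /e' /add_edge /= => ->.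
have nsH' : nonseparable e' H by apply: nonseparable_mono nsH => u v _ _; apply: ee'.
have sepH' : separated e' c' H by apply: (chord_separated esym csym HsubA cH sep E ni).
have [I [IH indI' le_I]] := IHn e' c' H e'sym e'irr c'sym ltHn nsH' sepH'.
have indI : {in I &, forall u v, ~~ e u v}.
  by move=> u v uI vI; apply: contra (indI' u v uI vI); apply: ee'.
have {}le_I : size (undup (colors e c H)) <= #|I|.
  apply: leq_trans le_I; apply: uniq_leq_size (undup_uniq _) _ => j.
  rewrite !mem_undup => /colorsP[u [v [uH vH euv ->]]].
  apply/colorsP; exists u, v; split=> //; first exact: ee'.
  by rewrite /c' /extend_coloring euv.
have [J [JA indJ le_J]] : exists J : {set V},
    [/\ J \subset A, {in J &, forall u v, ~~ e u v} & #|I| + m <= #|J|].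
  have [xI | xI] := boolP (x \in I); last first.
    exact: extend_independent_short SE size_s IH indI xI.
  have [yI | yI] := boolP (y \in I); last first.
    apply: extend_independent_short (shortest_ear_rev esym SE) _ IH indI yI => //.
    by rewrite size_rev.
  by have := indI' x y xI yI; rewrite /e' /add_edge /= !eqxx orbT.
by exists J; split=> //; apply: bound le_I le_J.
Qed.

End Graph.

Lemma k_connected2_nonseparable (G : sgraph) :
  k_connected 2 G -> nonseparable (@adj G) [set: G].
Proof.
case/andP=> _ /forallP k2; apply/nonseparableP => S S2.
have := k2 S; rewrite S2 /= => /forall_inP cS; apply/connP => x y.
by rewrite setTD => xS; move: y; apply/forall_inP; apply: cS.
Qed.

Lemma MD_coloring_separated (G : sgraph) (c : {set G} -> nat) :
  MD_coloring c -> separated (@adj G) (fun u v => c [set u; v]) [set: G].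
Proof.
case=> _ md x y _ _ /md[F [_ [i cF] sepF]]; exists i; apply: contra sepF.
apply: connect_sub => u v /and3P[_ _ /andP[uv ci]]; apply: connect1.
by rewrite /edge_deletion /= uv; apply: contra ci => /cF ->.
Qed.

Lemma md_le_alpha (G : sgraph) : k_connected 2 G -> md G <= alpha G.
Proof.
move=> k2; have [c mdc <-] := md_attained G.
have [I [_ indI le_I]] := colors_le_independent (@adj_sym G) (@adj_irrefl G)
  (fun u v => congr1 c (setUC [set u] [set v])) (ltnSn _)
  (k_connected2_nonseparable k2) (MD_coloring_separated mdc).
apply: leq_trans (_ : #|I| <= _).
  apply: leq_trans le_I; apply: uniq_leq_size (undup_uniq _) _ => i.
  rewrite !mem_undup => /mapP[f]; rewrite mem_enum => /imsetP[[u v]].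
  rewrite inE => uv -> ->; apply/colorsP; exists u, v.
  by rewrite !inE.
apply: (@leq_bigmax_cond _ (@independent G) (fun A => #|A|)).
by apply/forall_inP => u uI; apply/forall_inP => v vI; apply: indI.
Qed.

(** * Sharpness *)

Lemma md_gt0 (G : sgraph) (x y : G) : adj x y -> 0 < md G.
Proof.
move=> xy; apply: leq_trans (md_upper (const_MD_coloring G)).
have xyE : [set x; y] \in edges G.
  by apply/imsetP; exists (x, y); rewrite ?inE.
have : 1 \in undup [seq 1 | f in edges G].
  by rewrite mem_undup; apply/mapP; exists [set x; y]; rewrite ?mem_enum.
by rewrite /num_colors; case: (undup _).
Qed.

Definition triangle : sgraph :=
  @SGraph 'I_3 (fun u v => u != v) (fun u v => congr1 negb (eq_sym u v))
          (fun u => congr1 negb (eqxx u)).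

Lemma triangle_k_connected : k_connected 2 triangle.
Proof.
apply/andP; split; first by rewrite card_ord.
apply/forallP => S; apply/implyP => _.
apply/forall_inP => u uS; apply/forall_inP => v vS.
have [-> | uv] := eqVneq u v; first exact: connect0.
by apply: connect1; rewrite /= uS vS.
Qed.

Lemma alpha_triangle_le1 : alpha triangle <= 1.
Proof.
apply/bigmax_leqP => A /forall_inP indA.
rewrite leqNgt; apply/negP => /card_gt1P[u [v [uA vA uv]]].
by have /forall_inP/(_ v vA) := indA u uA; rewrite /= uv.
Qed.

Theorem theorem4p4 :
  (forall G : sgraph, k_connected 2 G -> md G <= alpha G) /\
  (exists G : sgraph, k_connected 2 G /\ md G = alpha G).
Proof.
split; first exact: md_le_alpha.
exists triangle; split; first exact: triangle_k_connected.
apply/eqP; rewrite eqn_leq md_le_alpha ?triangle_k_connected //=.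
apply: leq_trans alpha_triangle_le1 _.
exact: (@md_gt0 triangle ord0 ord_max).
Qed.
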